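(* Let $n\ge4$ and let $S_n=(V,E)$ be the star graph with $n$ vertices $V=\{a_1,a_2,\dots,a_n\}$ and center $a_1$ (the edges are exactly $\{a_1,a_i\}$, $2\le i\le n$). Then $$\|M_{S_n}\|_2=\left(1+\frac{n-4}{8}+\frac{(n^2+8n)^{1/2}}{8}\right)^{1/2}.$$
   Context: For a finite connected graph $G=(V,E)$, let $d_G(u,v)$ be the number of edges in a shortest path connecting $u$ and $v$, and let $B(e,r)=\{m\in V: d_G(e,m)\le r\}$. For $f:V\to\mathbb{R}$ the centered Hardy–Littlewood maximal function is $$M_Gf(e)=\max_{r\ge 0}\frac{1}{|B(e,r)|}\sum_{m\in B(e,r)}|f(m)|,\qquad e\in V.$$ With $\|g\|_2=\big(\sum_{e\in V}|g(e)|^2\big)^{1/2}$ for $g:V\to\mathbb{R}$, define $$\|M_G\|_2=\sup_{f:V\to\mathbb{R},\ f\ne0}\frac{\|M_Gf\|_2}{\|f\|_2}.$$ *)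

(* Defs.v *)
From mathcomp Require Import all_boot all_order all_algebra.
From mathcomp Require Import boolp classical_sets reals.

Set Implicit Arguments.
Unset Strict Implicit.
Unset Printing Implicit Defensive.

Import Order.TTheory GRing.Theory Num.Theory.
Local Open Scope classical_set_scope.
Local Open Scope ring_scope.

Record connected_graph := ConnectedGraph {
  vertex :> finType;
  edge : rel vertex;
  edge_sym : symmetric edge;
  edge_irrefl : irreflexive edge;
  edge_connected : forall u v, connect edge u v
}.

(* Least k such that some walk with k edges goes from u to v.  A shortest     *)
(* path repeats no vertex, so only the lengths k < #|G| have to be searched.  *)
Definition dist (G : connected_graph) (u v : G) : nat :=
  find (fun k => [exists p : k.-tuple G, path (@edge G) u p && (last u p == v)])
       (iota 0 #|G|).

Definition ball (G : connected_graph) (e : G) (r : nat) : {set G} :=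
  [set m | (dist e m <= r)%N].

Definition average (R : realType) (G : connected_graph) (f : G -> R)
    (e : G) (r : nat) : R :=
  (#|ball e r|%:R)^-1 * \sum_(m in ball e r) `|f m|.

(* Distances are integers, so integer radii give all the balls.  Only         *)
(* finitely many averages are distinct, so this supremum is a maximum: see    *)
(* maximal_max.                                                               *)
Definition maximal (R : realType) (G : connected_graph) (f : G -> R) (e : G) : R :=
  sup [set average f e r | r in [set: nat]].

Definition l2norm (R : realType) (T : finType) (g : T -> R) : R :=
  Num.sqrt (\sum_(e : T) `|g e| ^+ 2).

(* The set of quotients is bounded above, by Num.sqrt #|G|%:R, so that the    *)
(* value 0 that sup takes on unbounded sets plays no role.                    *)
Definition maximal_opnorm (R : realType) (G : connected_graph) : R :=
  sup [set l2norm (maximal f) / l2norm f |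
        f in [set f : G -> R | f <> (fun=> 0)]].

(* The center is the vertex of value 0.                                       *)
Definition star_edge (n : nat) : rel 'I_n :=
  fun i j => ((val i == 0) && (val j != 0)) || ((val j == 0) && (val i != 0)).

Lemma star_edge_sym n : symmetric (@star_edge n).
Proof. by move=> i j; rewrite /star_edge orbC. Qed.

Lemma star_edge_irrefl n : irreflexive (@star_edge n).
Proof. by move=> i; rewrite /star_edge andbN. Qed.

Lemma star_edge_connected n (u v : 'I_n) : connect (@star_edge n) u v.
Proof.
case: n u v => [[]//|n] u v.
have c0 (w : 'I_n.+1) : connect (@star_edge n.+1) ord0 w.
  have [->|w0] := eqVneq w ord0; first exact: connect0.
  by apply: connect1; rewrite /star_edge /= w0.
apply: (connect_trans _ (c0 v)).
by rewrite (sym_connect_sym (@star_edge_sym n.+1)).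
Qed.

Definition star_graph (n : nat) : connected_graph :=
  ConnectedGraph (@star_edge_sym n) (@star_edge_irrefl n)
    (@star_edge_connected n).

Section MaximalIsMax.
Variables (R : realType) (G : connected_graph).
Implicit Types (f : G -> R) (e m : G) (r : nat).

Lemma dist_le_card e m : (dist e m <= #|G|)%N.
Proof. by rewrite -[leqRHS](size_iota 0) find_size. Qed.

Lemma average_minn f e r : average f e r = average f e (minn r #|G|).
Proof.
rewrite /average; suff -> : ball e r = ball e (minn r #|G|) by [].
by apply/setP => m; rewrite !inE leq_min dist_le_card andbT.
Qed.

Lemma maximal_max f e :
  exists2 r, maximal f e = average f e r &
    forall s, average f e s <= average f e r.
Proof.
have [i _ imax] := arg_maxP (fun i : 'I_#|G|.+1 => average f e i)
  (erefl : xpredT (@ord0 #|G|)).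
have ub s : average f e s <= average f e i.
  rewrite average_minn; have h : (minn s #|G| < #|G|.+1)%N.
    by rewrite ltnS geq_minr.
  exact: (imax (Ordinal h)).
exists (i : nat) => //; apply/eqP; rewrite eq_le; apply/andP; split.
  apply: ge_sup; first by exists (average f e 0); exists 0%N.
  by move=> _ [s _ <-].
apply: ub_le_sup; last by exists (i : nat).
by exists (average f e i) => _ [s _ <-].
Qed.

End MaximalIsMax.

(* Main.v *)
Require Import Defs.
From mathcomp Require Import all_boot all_order all_algebra.
From mathcomp Require Import boolp classical_sets reals.
From mathcomp Require Import ring lra.

(** Write [x] for the value of [|f|] at the center of the star with [n]
    vertices, [y_i] for its values at the leaves, and [A] for the mean of [|f|]
    over all vertices.  A ball of the star is a vertex, an edge around a leaf,
    or everything, so [M f] is [max(x, A)] at the center and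
    [max(y_i, (x + y_i) / 2, A)] at a leaf.

    If only the edge averages mattered, [||M f||^2] would be the quadratic form
    [x^2 + sum_i ((x + y_i) / 2)^2], whose largest eigenvalue [lam] is the
    larger root of [4 lam^2 - (n + 4) lam + 1] and has the eigenvector
    [(4 lam - 1, 1, ..., 1)].  This vector gives the lower bound
    ([star_eigenvector]), and [lam] is the square of the asserted norm.  It
    remains to see that the mean [A] never helps.

    - If [x < A], the edge averages are dominated by [max(y_i, A)], so that
      [M f <= max(|f|, A)] everywhere, and replacing values below the mean by
      the mean multiplies the sum of squares by at most [4 / 3]
      ([sum_sqr_max_mean]); this is less than [lam >= 1 + (n - 1) / 4].
    - If [A <= x], let [k] leaves take the value [A].  Since [A^2] is at most
      [||f||^2 / n], they cost at most [k / n] times [||f||^2].  What is left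
      is a star with [n - k] vertices, and the eigenvalue drops by at least
      [k / n] when [k] leaves are removed ([sub_star_eigenvalue]); this
      is where [n >= 4] enters.

    Both cases are put together in [star_upper_bound]. *)

Import Order.TTheory GRing.Theory Num.Theory.
Local Open Scope ring_scope.

(** * Balls in graphs and in stars *)

Lemma dist_last_le {G : connected_graph} (u : G) (p : seq G) :
  path (@edge G) u p -> (size p < #|G|)%N -> (dist u (last u p) <= size p)%N.
Proof.
move=> up sp; rewrite leqNgt; apply/negP => /(before_find 0%N).
rewrite nth_iota // add0n => /existsP; apply.
by exists (in_tuple p); rewrite /= up eqxx.
Qed.

Lemma dist_walk {G : connected_graph} (u v : G) : (dist u v < #|G|)%N ->
  exists p, [/\ path (@edge G) u p, last u p = v & size p = dist u v].
Proof.
move=> duv; have h : has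
    (fun k => [exists p : k.-tuple G, path (@edge G) u p && (last u p == v)])
    (iota 0 #|G|) by rewrite has_find size_iota.
have := nth_find 0%N h; rewrite -/(dist u v) nth_iota // add0n.
by case/existsP=> p /andP[up /eqP uv]; exists p; rewrite size_tuple.
Qed.

Lemma ball0 {G : connected_graph} (e : G) : ball e 0 = [set e].
Proof.
have G0 : (0 < #|G|)%N by apply/card_gt0P; exists e.
apply/setP => m; rewrite !inE leqn0; apply/idP/idP => [/eqP d0|/eqP ->].
  have [|p [_ em sp]] := dist_walk e m; first by rewrite d0.
  by move: sp em; rewrite d0 => /size0nil -> /= ->.
by rewrite -leqn0; exact: (@dist_last_le G e [::]).
Qed.

Lemma ball1 {G : connected_graph} (e : G) : (1 < #|G|)%N ->
  ball e 1 = e |: [set m | edge e m].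
Proof.
move=> G1; apply/setP => m; rewrite !inE; apply/idP/idP => [d1|/orP[/eqP ->|em]].
- have [|p [ep em sp]] := dist_walk e m; first exact: leq_ltn_trans d1 G1.
  move: d1; rewrite -sp; case: p ep em {sp} => [_ /= ->|a [|//] /=].
    by rewrite eqxx.
  by rewrite andbT => ea <-; rewrite ea orbT.
- by apply: leq_trans (dist_last_le e [::] isT _) _; rewrite // ltnW.
- by apply: (dist_last_le e [:: m]); rewrite //= em.
Qed.

Lemma star_edge_center (n : nat) (i : 'I_n.+1) :
  star_edge ord0 i = (i != ord0).
Proof. by rewrite /star_edge /= andbF orbF. Qed.

Lemma star_edge_leaf (n : nat) (i : 'I_n) (j : 'I_n.+1) :
  star_edge (lift ord0 i) j = (j == ord0).
Proof. by rewrite /star_edge /= andbT. Qed.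

Lemma star_ball_center (n r : nat) : (0 < n)%N ->
  ball (ord0 : star_graph n.+1) r.+1 = [set: star_graph n.+1].
Proof.
move=> n0; apply/setP => m; rewrite !inE.
have [->|m0] := eqVneq m ord0.
  by apply: leq_trans (dist_last_le _ [::] isT _) _; rewrite // card_ord.
apply: leq_trans (dist_last_le _ [:: m] _ _) _; rewrite ?card_ord //=.
by rewrite star_edge_center m0.
Qed.

Lemma star_ball_leaf1 (n : nat) (i : 'I_n) :
  ball (lift ord0 i : star_graph n.+1) 1 = [set lift ord0 i; ord0].
Proof.
rewrite ball1; last by rewrite card_ord; case: n i => [[]|].
by congr (_ :|: _); apply/setP => m; rewrite !inE /= star_edge_leaf.
Qed.

Lemma star_ball_leaf2 (n r : nat) (i : 'I_n) : (1 < n)%N ->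
  ball (lift ord0 i : star_graph n.+1) r.+2 = [set: star_graph n.+1].
Proof.
move=> n1; set u := (lift ord0 i : star_graph n.+1).
apply/setP => m; rewrite !inE.
have [->|m0] := eqVneq m ord0.
  apply: leq_trans (dist_last_le u [:: ord0] _ _) _; rewrite ?card_ord //=.
  exact: ltnW.
apply: leq_trans (dist_last_le u [:: ord0; m] _ _) _; rewrite ?card_ord //=.
by rewrite star_edge_center m0.
Qed.

(** * The maximal function of a star *)

Definition mean {R : realFieldType} {T : finType} (z : T -> R) : R :=
  (#|T|%:R)^-1 * \sum_i z i.

Lemma average_le_maximal (R : realType) (G : connected_graph) (f : G -> R) e r :
  average f e r <= maximal f e.
Proof. by have [s -> sP] := maximal_max f e; exact: sP. Qed.

Lemma average0 (R : realType) (G : connected_graph) (f : G -> R) e :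
  average f e 0 = `|f e|.
Proof. by rewrite /average ball0 big_set1 cards1 invr1 mul1r. Qed.

Lemma average_setT (R : realType) (G : connected_graph) (f : G -> R) e r :
  ball e r = [set: G] -> average f e r = mean (fun m => `|f m|).
Proof.
move=> eT; rewrite /average eT cardsT /mean; congr (_ * _).
by apply: eq_bigl => m; rewrite inE.
Qed.

Lemma star_average_leaf1 (R : realType) (n : nat) (f : star_graph n.+1 -> R)
    (i : 'I_n) :
  average f (lift ord0 i) 1 = (`|f ord0| + `|f (lift ord0 i)|) / 2.
Proof.
rewrite /average star_ball_leaf1 cards2 big_setU1 ?inE //= big_set1.
by rewrite mulrC addrC.
Qed.

Lemma star_maximal_center (R : realType) (n : nat) (f : star_graph n.+1 -> R) :
  (0 < n)%N ->
  maximal f ord0 = Num.max `|f ord0| (mean (fun m => `|f m|)).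
Proof.
move=> n0; apply/eqP; rewrite eq_le; apply/andP; split.
  have [[|r] -> _] := maximal_max f ord0; first by rewrite average0 le_max lexx.
  by rewrite average_setT ?star_ball_center // le_max lexx orbT.
rewrite ge_max -(average0 _ _ f) average_le_maximal /=.
by rewrite -(average_setT _ _ _ _ _ (star_ball_center n 0 n0)) average_le_maximal.
Qed.

Lemma star_maximal_leaf (R : realType) (n : nat) (f : star_graph n.+1 -> R)
    (i : 'I_n) : (1 < n)%N ->
  maximal f (lift ord0 i) =
  Num.max (Num.max `|f (lift ord0 i)| ((`|f ord0| + `|f (lift ord0 i)|) / 2))
    (mean (fun m => `|f m|)).
Proof.
move=> n1; apply/eqP; rewrite eq_le; apply/andP; split.
  have [[|[|r]] -> _] := maximal_max f (lift ord0 i).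
  - by rewrite average0 !le_max lexx.
  - by rewrite star_average_leaf1 !le_max lexx !orbT.
  - by rewrite average_setT ?star_ball_leaf2 // !le_max lexx !orbT.
rewrite !ge_max -star_average_leaf1 -(average0 _ _ f) !average_le_maximal /=.
by rewrite -(average_setT _ _ _ _ _ (star_ball_leaf2 n 0 i n1)) average_le_maximal.
Qed.

(** * Sums of squares and the mean *)

Lemma sum_sqr_sub_mean {R : realFieldType} {T : finType} (z : T -> R) (c : R) :
  \sum_i (z i - c * mean z) ^+ 2 =
  \sum_i z i ^+ 2 + (c ^+ 2 - 2 * c) * (#|T|%:R * mean z ^+ 2).
Proof.
have sumE : \sum_i z i = #|T|%:R * mean z.
  have [T0|T0] := posnP #|T|; last by rewrite /mean mulVKf // pnatr_eq0 -lt0n.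
  by rewrite T0 mul0r big1 // => i; have := card0_eq T0 i; rewrite !inE.
under eq_bigr do rewrite sqrrB.
rewrite !big_split /= sumr_const sumrN sumrMnl.
by rewrite -mulr_suml sumE -[_ *+ #|T|]mulr_natl; ring.
Qed.

Lemma mean_sqr_le {R : realFieldType} {T : finType} (z : T -> R) :
  #|T|%:R * mean z ^+ 2 <= \sum_i z i ^+ 2.
Proof.
have := sum_sqr_sub_mean z 1.
have : 0 <= \sum_i (z i - 1 * mean z) ^+ 2 by apply: sumr_ge0 => i _; exact: sqr_ge0.
lra.
Qed.

(** With [A] the mean, [max(z, A)^2 <= z^2 + (z - 2 A)^2 / 3] for [z >= 0]: the
    gap is [(2 z - A)^2 / 3] when [z <= A].  The value [2 A] is chosen because
    the [(z_i - 2 A)^2] have the same sum as the [z_i^2]; equality holds if a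
    third of the entries are [2 A] and the others [A / 2]. *)
Lemma sum_sqr_max_mean {R : realFieldType} {T : finType} (z : T -> R) :
  \sum_i Num.max (z i) (mean z) ^+ 2 <= 4 / 3 * \sum_i z i ^+ 2.
Proof.
apply: (@le_trans _ _ (\sum_i (z i ^+ 2 + (z i - 2 * mean z) ^+ 2 / 3))).
  apply: ler_sum => i _; set A := mean z.
  have h1 := sqr_ge0 (2 * z i - A); have h2 := sqr_ge0 (z i - 2 * A).
  by case: (leP (z i) A) => _; lra.
by rewrite big_split /= -mulr_suml sum_sqr_sub_mean; lra.
Qed.

(** * The quadratic form of a star *)

(** The polynomial in the conclusion is, up to a factor, the characteristic
    polynomial of the form [x^2 + sum_i ((x + y_i) / 2)^2] for a star with
    [n - k] vertices.  It is nonnegative at [lam - k / n] because the larger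
    eigenvalue grows with [n] at a rate above [1 / 4], so that removing [k]
    leaves lowers it by at least [k / 4 >= k / n]. *)
Lemma sub_star_eigenvalue {R : realFieldType} (n k lam : R) :
  4 <= n -> 0 <= k <= n ->
  4 * lam ^+ 2 - (n + 4) * lam + 1 = 0 -> 0 < lam ->
  0 <= 4 * (lam - k / n) ^+ 2 - (n - k + 4) * (lam - k / n) + 1.
Proof.
move=> n4 /andP[k0 kn] lamE lam0; set h := k / n.
have n0 : 0 < n by lra.
have kE : k = n * h by rewrite /h mulrC divfK ?gt_eqF.
have h0 : 0 <= h by rewrite divr_ge0 // ltW.
have h1 : h <= 1 by rewrite ler_pdivrMr // mul1r.
have lam_le : lam <= 1 + n / 4.
  rewrite leNgt; apply/negP => lt; suff : 0 < lam * (4 * lam - (n + 4)) by lra.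
  by apply: mulr_gt0 => //; lra.
have -> : 4 * (lam - h) ^+ 2 - (n - k + 4) * (lam - h) + 1 =
    4 * lam ^+ 2 - (n + 4) * lam + 1 +
    h * ((n - 8) * lam + 8 + (n - 4) * (1 - h)) by rewrite kE; ring.
rewrite lamE add0r mulr_ge0 // addr_ge0 //; last by apply: mulr_ge0; lra.
have [n8|n8] := leP 8 n.
  by have : 0 <= (n - 8) * lam; [apply: mulr_ge0; lra | lra].
have : 0 <= (8 - n) * (1 + n / 4 - lam) by apply: mulr_ge0; lra.
have : 0 <= n * (n - 4) by apply: mulr_ge0; lra.
lra.
Qed.

(** Cauchy-Schwarz with the weights [1 / (4 l - 1)] and [1], for which equality
    holds at the eigenvector [x = (4 l - 1) y]. *)
Lemma edge_average_sqr_le {R : realFieldType} (l x y : R) : 1 <= l ->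
  ((x + y) / 2) ^+ 2 <= l * (x ^+ 2 / (4 * l - 1) + y ^+ 2).
Proof.
move=> l1; have D0 : 0 < 4 * l - 1 by lra.
rewrite -subr_ge0.
have -> : l * (x ^+ 2 / (4 * l - 1) + y ^+ 2) - ((x + y) / 2) ^+ 2 =
    (x - (4 * l - 1) * y) ^+ 2 / (4 * (4 * l - 1)) by field; rewrite gt_eqF.
by apply: divr_ge0; [exact: sqr_ge0 | lra].
Qed.

Lemma star_upper_bound {R : realFieldType} (n : nat) (z : 'I_n.+1 -> R) (lam : R) :
  (3 <= n)%N -> (forall i, 0 <= z i) ->
  4 * lam ^+ 2 - (n.+1%:R + 4) * lam + 1 = 0 -> 1 + n%:R / 4 <= lam ->
  Num.max (z ord0) (mean z) ^+ 2 +
    \sum_(i < n) Num.max (Num.max (z (lift ord0 i))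
      ((z ord0 + z (lift ord0 i)) / 2)) (mean z) ^+ 2
  <= lam * \sum_i z i ^+ 2.
Proof.
move=> n3 z0 lamE lam_ge.
have n3R : 3 <= n%:R :> R by rewrite ler_nat.
have S0 : 0 <= \sum_i z i ^+ 2 by apply: sumr_ge0 => i _; exact: sqr_ge0.
set x := z ord0; pose y i := z (lift ord0 i); set A := mean z.
have [xA|Ax] := ltP x A.
  apply: (@le_trans _ _ (4 / 3 * \sum_i z i ^+ 2)); last first.
    by apply: ler_wpM2r => //; lra.
  apply: le_trans (sum_sqr_max_mean z); rewrite big_ord_recl.
  rewrite (max_idPr (ltW xA)) lerD //.
  apply: ler_sum => i _; rewrite -/A -/(y i).
  have y0 : 0 <= y i by exact: z0.
  have A0 : 0 <= A by apply: le_trans (ltW xA); exact: z0.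
  (* An edge average lies between [x] and [y i], hence below [max(y i, A)]. *)
  rewrite ler_sqr ?nnegrE; try by rewrite !le_max ?y0 ?A0 ?orbT.
  rewrite !ge_max !le_max !lexx orbT /=.
  by case: (leP (y i) A) => yA; apply/andP; split=> //; lra.
(* Leaves in [B] keep an edge average or their own value; the others take [A]. *)
pose B := [pred i | A < Num.max (y i) ((x + y i) / 2)].
pose k : R := (#|[predC B]|)%:R.
(* What remains of [lam] once the leaves taking [A] are paid for. *)
pose l := lam - k / n.+1%:R.
have x0 : 0 <= x by exact: z0.
have cardB : #|B|%:R = n%:R - k.
  apply/eqP; rewrite eq_sym subr_eq -natrD; apply/eqP; congr (_%:R).
  by rewrite cardC card_ord.
have k0 : 0 <= k by exact: ler0n.
have kn : k <= n%:R by rewrite -subr_ge0 -cardB ler0n.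
have nS : n.+1%:R = n%:R + 1 :> R by rewrite -(addn1 n) natrD.
have n1 : 0 < n.+1%:R :> R by exact: ltr0Sn.
have l1 : 1 <= l.
  have : k / n.+1%:R <= n%:R / 4.
    by apply: ler_pM => //; [rewrite invr_ge0 ltW | rewrite lef_pV2 ?posrE //; lra].
  by rewrite /l; move: (k / _) => h; lra.
have D0 : 0 < 4 * l - 1 by lra.
(* Each leaf in [B] will cost [l / (4 l - 1)] times [x ^+ 2], while the center
   can spare [l - 1] times [x ^+ 2]. *)
have charP : #|B|%:R * l <= (l - 1) * (4 * l - 1).
  have := @sub_star_eigenvalue R n.+1%:R k lam.
  rewrite -/l cardB nS => /(_ ltac:(lra) ltac:(lra)).
  rewrite nS in lamE => /(_ lamE ltac:(lra)); lra.
have BE (i : 'I_n) : i \in B -> Num.max (Num.max (y i) ((x + y i) / 2)) A ^+ 2 <=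
    l * (x ^+ 2 / (4 * l - 1)) + l * y i ^+ 2.
  rewrite inE => /ltW /max_idPl ->; rewrite -mulrDr.
  case: (leP (y i) ((x + y i) / 2)) => _; first exact: edge_average_sqr_le.
  have y2 := sqr_ge0 (y i).
  have x2 : 0 <= x ^+ 2 / (4 * l - 1).
    by apply: divr_ge0; [exact: sqr_ge0 | exact: ltW].
  have : 0 <= (l - 1) * y i ^+ 2 by apply: mulr_ge0; lra.
  have : 0 <= l * (x ^+ 2 / (4 * l - 1)) by apply: mulr_ge0; lra.
  lra.
have sumB : \sum_(i in B) Num.max (Num.max (y i) ((x + y i) / 2)) A ^+ 2 <=
    (l - 1) * x ^+ 2 + l * \sum_i y i ^+ 2.
  apply: le_trans (ler_sum _ BE) _; rewrite big_split /= sumr_const -mulr_sumr.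
  apply: lerD.
    rewrite -[leLHS]mulr_natl 2![leLHS]mulrA ler_pdivrMr // [leRHS]mulrAC.
    by apply: ler_wpM2r charP; exact: sqr_ge0.
  apply: ler_wpM2l; first by lra.
  rewrite [leRHS](bigID (mem B)) /= lerDl.
  by apply: sumr_ge0 => i _; exact: sqr_ge0.
have sumC : \sum_(i | i \notin B) Num.max (Num.max (y i) ((x + y i) / 2)) A ^+ 2 =
    k * A ^+ 2.
  rewrite /k mulr_natl -sumr_const; apply: eq_bigr => i.
  by rewrite !inE -leNgt => /max_idPr ->.
have kA : k * A ^+ 2 <= k / n.+1%:R * \sum_i z i ^+ 2.
  rewrite -mulrA; apply: ler_wpM2l => //; rewrite ler_pdivlMl //.
  by have := mean_sqr_le z; rewrite card_ord.
have sumE : \sum_i z i ^+ 2 = x ^+ 2 + \sum_i y i ^+ 2 by rewrite big_ord_recl.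
rewrite (bigID (mem B)) /= sumC addrA.
have lamlE : lam = l + k / n.+1%:R by rewrite /l subrK.
rewrite lamlE mulrDl; apply: lerD kA; rewrite sumE.
by apply: le_trans (lerD (lexx _) sumB) _; lra.
Qed.

(** At the eigenvector [(4 lam - 1, 1, ..., 1)] the quadratic form is exactly
    [lam] times the sum of squares. *)
Lemma star_eigenvector {R : realFieldType} (n : nat) (lam : R) :
  4 * lam ^+ 2 - (n.+1%:R + 4) * lam + 1 = 0 ->
  (4 * lam - 1) ^+ 2 + ((4 * lam - 1 + 1) / 2) ^+ 2 *+ n =
  lam * ((4 * lam - 1) ^+ 2 + 1 *+ n).
Proof.
rewrite -(addn1 n) natrD => lamE; rewrite -[_ ^+ 2 *+ n]mulr_natl.
have nE : n%:R * lam = 4 * lam ^+ 2 - 5 * lam + 1 :> R by lra.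
have -> : n%:R * ((4 * lam - 1 + 1) / 2) ^+ 2 = 4 * (n%:R * lam) * lam by field.
have -> : lam * ((4 * lam - 1) ^+ 2 + n%:R) =
    lam * (4 * lam - 1) ^+ 2 + n%:R * lam by ring.
by rewrite nE; ring.
Qed.

(** * The operator norm *)

Lemma l2norm_gt0 {R : realType} {T : finType} (f : T -> R) :
  f <> (fun=> 0) -> 0 < l2norm f.
Proof.
move=> f0; rewrite sqrtr_gt0 lt_neqAle sumr_ge0 ?andbT; last first.
  by move=> e _; exact: sqr_ge0.
apply/negP => /eqP /esym s0; apply: f0; apply/funext => e.
have /eqP : `|f e| ^+ 2 = 0.
  by apply: (psumr_eq0P _ s0) => // i _; exact: sqr_ge0.
by rewrite expf_eq0 /= normr_eq0 => /eqP.
Qed.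

Lemma maximal_opnormE (R : realType) (G : connected_graph) (lam : R)
    (f : G -> R) :
  0 <= lam -> f <> (fun=> 0) ->
  (forall g : G -> R,
    \sum_e `|maximal g e| ^+ 2 <= lam * \sum_e `|g e| ^+ 2) ->
  lam * \sum_e `|f e| ^+ 2 <= \sum_e `|maximal f e| ^+ 2 ->
  maximal_opnorm R G = Num.sqrt lam.
Proof.
move=> lam0 f0 ub lb.
have quot_le (g : G -> R) :
    g <> (fun=> 0) -> l2norm (maximal g) / l2norm g <= Num.sqrt lam.
  move=> g0; rewrite ler_pdivrMr ?l2norm_gt0 // /l2norm -sqrtrM //.
  by apply: ler_wsqrtr; exact: ub.
apply/eqP; rewrite eq_le; apply/andP; split.
  apply: ge_sup; first by exists (l2norm (maximal f) / l2norm f), f.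
  by move=> _ [g g0 <-]; exact: quot_le.
apply: (@le_trans _ _ (l2norm (maximal f) / l2norm f)).
  by rewrite ler_pdivlMr ?l2norm_gt0 // /l2norm -sqrtrM //; exact: ler_wsqrtr.
apply: ub_le_sup; last by exists f.
by exists (Num.sqrt lam) => _ [g g0 <-]; exact: quot_le.
Qed.

Theorem theorem6 (R : realType) (n : nat) (hn : (4 <= n)%N) :
  maximal_opnorm R (star_graph n) =
  Num.sqrt (1 + (n%:R - 4) / 8 + Num.sqrt (n%:R ^+ 2 + 8 * n%:R) / 8).
Proof.
case: n hn => // n; rewrite ltnS => n3.
set s := Num.sqrt (_ ^+ 2 + _); set lam := (1 + _ + _).
have nS : n.+1%:R = n%:R + 1 :> R by rewrite -(addn1 n) natrD.
have n3R : 3 <= n%:R :> R by rewrite ler_nat.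
have s2 : s ^+ 2 = n.+1%:R ^+ 2 + 8 * n.+1%:R.
  by rewrite sqr_sqrtr // nS; have := sqr_ge0 (n%:R + 1 : R); lra.
have s_ge : n.+1%:R + 2 <= s.
  rewrite -ler_sqr ?nnegrE ?sqrtr_ge0 ?s2 //; rewrite nS; [nra | lra].
have lamE : 4 * lam ^+ 2 - (n.+1%:R + 4) * lam + 1 = 0.
  have -> : 4 * lam ^+ 2 - (n.+1%:R + 4) * lam + 1 =
      (s ^+ 2 - (n.+1%:R ^+ 2 + 8 * n.+1%:R)) / 16 by rewrite /lam; field.
  by rewrite s2 subrr mul0r.
have lam_ge : 1 + n%:R / 4 <= lam.
  by rewrite nS in s_ge; rewrite /lam nS; lra.
(* The eigenvector of the quadratic form. *)
pose f (i : star_graph n.+1) : R := if i == ord0 then 4 * lam - 1 else 1.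
have f0 : f ord0 = 4 * lam - 1 by rewrite /f eqxx.
have fS (i : 'I_n) : f (lift ord0 i) = 1 by [].
have normr2 (a : R) : `|a| ^+ 2 = a ^+ 2 by rewrite real_normK ?num_real.
apply: (@maximal_opnormE _ _ _ f); first by lra.
- by move=> /(congr1 (fun g => g ord0)); rewrite f0 /=; lra.
- move=> g; apply: le_trans (star_upper_bound n (fun i => `|g i|) lam _ _ _ _) => //.
  rewrite big_ord_recl normr2 star_maximal_center; last exact: ltn_trans n3.
  rewrite lerD //; apply: ler_sum => i _.
  by rewrite normr2 star_maximal_leaf //; exact: ltn_trans n3.
rewrite !big_ord_recl f0 normr2; under eq_bigr do rewrite fS normr1 expr1n.
rewrite sumr_const card_ord -star_eigenvector //.
apply: lerD.
  rewrite ler_sqr ?nnegrE ?normr_ge0 //; last by lra.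
  apply: le_trans (ler_norm _); rewrite -f0; apply: le_trans (ler_norm _) _.
  by rewrite -(average0 _ _ f) average_le_maximal.
rewrite -[in leLHS](card_ord n) -sumr_const; apply: ler_sum => i _.
rewrite ler_sqr ?nnegrE ?normr_ge0 //; last by lra.
apply: le_trans (ler_norm _).
apply: le_trans (average_le_maximal _ _ f (lift ord0 i) 1).
by rewrite star_average_leaf1 fS normr1 f0 ger0_norm //; lra.
Qed.
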